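(* Let $n\ge 1$, and let $A_n$ and $B_n$ be the $2^n\times 2^n$ matrices defined recursively in the context. (i) The roots of the characteristic polynomial of $A_n$ are in $2:1$ correspondence with the compositions of $n$: each composition $\mu=(\mu_1,\ldots,\mu_t)$ of $n$ corresponds to a pair of eigenvalues $\pm\sqrt{\pi_\mu}$ of $A_n$, where $$\pi_\mu:=\prod_{i=1}^{t}(\mu_i+1).$$ That is, the multiset of roots of the characteristic polynomial of $A_n$ (counted with algebraic multiplicity) is the multiset union, over all compositions $\mu$ of $n$, of the two-element multisets $\{\sqrt{\pi_\mu},-\sqrt{\pi_\mu}\}$. (ii) Similarly, the roots of the characteristic polynomial of $B_n$ are in $2:1$ correspondence with the compositions of $n$: each composition $\mu=(\mu_1,\ldots,\mu_t)$ of $n$ corresponds to a pair of eigenvalues $\pm\sqrt{\pi'_\mu}$ of $B_n$, where $$\pi'_\mu:=\prod_{i=1}^{t-1}(\mu_i+1).$$ That is, the multiset of roots of the characteristic polynomial of $B_n$ (counted with algebraic multiplicity) is the multiset union, over all compositions $\mu$ of $n$, of the two-element multisets $\{\sqrt{\pi'_\mu},-\sqrt{\pi'_\mu}\}$.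
   Context: The matrices $A_n,B_n$ ($n\ge 0$) of size $2^n\times 2^n$ are defined recursively by $A_0=B_0=(1)$ and, for $n\ge1$, $$A_n=\begin{pmatrix} A_{n-1} & A_{n-1} \\ A_{n-1} & -B_{n-1} \end{pmatrix},\qquad B_n=\begin{pmatrix} A_{n-1} & A_{n-1} \\ 0 & -B_{n-1} \end{pmatrix}.$$ A composition of $n$ is a finite sequence $(\mu_1,\ldots,\mu_t)$ of positive integers (order matters) with $\mu_1+\cdots+\mu_t=n$. An empty product equals $1$. *)

(* Defs.v *)
From HB Require Import structures.
From mathcomp Require Import all_boot all_order all_algebra.

Set Implicit Arguments.
Unset Strict Implicit.
Unset Printing Implicit Defensive.

Import Order.TTheory GRing.Theory Num.Theory.

Lemma addn_exp2 n : 2 ^ n + 2 ^ n = 2 ^ n.+1.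
Proof. by rewrite addnn -mul2n -expnS. Qed.

Section Matrices.
Variable R : pzRingType.
Local Open Scope ring_scope.

(* The cast only identifies the dimension 2 ^ n + 2 ^ n with 2 ^ n.+1. *)
Fixpoint mxA (n : nat) : 'M[R]_(2 ^ n) :=
  if n is m.+1 then
    castmx (addn_exp2 m, addn_exp2 m)
      (block_mx (mxA m) (mxA m) (mxA m) (- mxB m))
  else const_mx 1
with mxB (n : nat) : 'M[R]_(2 ^ n) :=
  if n is m.+1 then
    castmx (addn_exp2 m, addn_exp2 m)
      (block_mx (mxA m) (mxA m) 0 (- mxB m))
  else const_mx 1.

End Matrices.

Definition is_composition (n : nat) (mu : seq nat) : bool :=
  all (leq 1) mu && (sumn mu == n).

(* The parts of a composition of n, and their number, are at most n, so it is
   enough to filter the finite type of sequences of length <= n with entries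
   <= n; see mem_compositions and compositions_uniq. *)
Definition compositions (n : nat) : seq (seq nat) :=
  [seq mu <- [seq map val (bseqval t) | t : n.-bseq 'I_n.+1]
  | is_composition n mu].

Lemma mem_compositions (n : nat) (mu : seq nat) :
  (mu \in compositions n) = is_composition n mu.
Proof.
rewrite mem_filter andb_idr // => /andP[mu_gt0 /eqP sum_mu].
have size_mu : size mu <= n.
  rewrite -sum_mu; elim: mu mu_gt0 {sum_mu} => //= m mu IH /andP[m_gt0 /IH].
  by rewrite -add1n; apply: leq_add.
have le_mu m : m \in mu -> m < n.+1.
  rewrite ltnS -sum_mu; elim: mu {mu_gt0 sum_mu size_mu} => //= a mu IH.
  rewrite inE => /orP[/eqP-> | /IH /leq_trans]; first exact: leq_addr.
  by apply; apply: leq_addl.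
have size_t : size (map (@inord n) mu) <= n by rewrite size_map.
apply/imageP; exists (Bseq size_t) => //=.
rewrite -map_comp -[LHS]map_id; apply/eq_in_map => m /le_mu m_lt /=.
by rewrite inordK.
Qed.

Lemma compositions_uniq (n : nat) : uniq (compositions n).
Proof.
rewrite filter_uniq // map_inj_uniq ?enum_uniq // => t u /(inj_map val_inj).
exact: val_inj.
Qed.

Definition pi_full (mu : seq nat) : nat :=
  \prod_(i < size mu) (nth 0 mu i + 1).

Definition pi_init (mu : seq nat) : nat :=
  \prod_(i < (size mu).-1) (nth 0 mu i + 1).

Section Roots.
Local Open Scope ring_scope.

(* Roots listed with multiplicity, in an unspecified order; meaningful for
   p != 0 only. *)
Definition poly_roots (C : closedFieldType) (p : {poly C}) : seq C :=
  sval (closed_field_poly_normal p).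

Definition sqrt_pairs (C : numClosedFieldType) (s : seq nat) : seq C :=
  flatten [seq [:: sqrtC a%:R; - sqrtC a%:R] | a <- s].

End Roots.

(* Main.v *)
Require Import Defs.
From mathcomp Require Import all_boot all_order all_algebra.
From mathcomp Require Import ring.

Set Implicit Arguments.
Unset Strict Implicit.
Unset Printing Implicit Defensive.

Import Order.TTheory GRing.Theory Num.Theory.

Local Open Scope ring_scope.

(** Put N_n = A_n - B_n. The recursion reads
      A_(n+1) = [ A_n, A_n ; A_n, N_n - A_n ],   N_(n+1) = [ 0, 0 ; A_n, 0 ],
    so the pair (A_n, N_n) determines the next one, compatibly with base change
    and with block triangular form. The idea is that (A_n, N_n) can be brought
    simultaneously to block upper triangular form with diagonal blocks of size
    two
      [ 0, a ; 1, 0 ]  for A_n   and   [ 0, y ; 0, 0 ]  for N_n,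
    that is, with basis vectors v, w such that A v = w, A w = a v, N v = 0 and
    N w = y v modulo the earlier ones. Call this the cell (a, y); it contributes
    the factor X^2 - a to the characteristic polynomial of A_n.

    One step of the recursion turns v, w into (0, v), (w, -w) and (w, w),
    (2 a v, 0), where (x, x') stands for a vector written in two blocks.
    In this basis the pair built from the cell (a, y) is block triangular with
    cells (2 a - y, a) and (2 a, a) (factors_lift_cell). If a = P (m + 1) and
    y = P m, where m is the last part of a composition and P is the product of
    (part + 1) over the other parts, then these two cells are those of the
    composition with last part m + 1 instead of m, and of the composition with
    a further part 1. For n > 0, every composition of n + 1 arises in exactly
    one way from one of n, and A_1 is a single cell for the composition (1);
    hence char(A_n) is the product of X^2 - pi_mu (factors_mxA, char_poly_mxA).

    The matrix B_(n+1) is block triangular with diagonal blocks A_n and - B_n,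
    so its characteristic polynomial follows by induction (char_poly_mxB):
    dropping the last part, the factors X^2 - pi_mu of A_n account for the
    compositions ending in 1 and those of - B_n for the others. *)

(** * Characteristic polynomials *)

Lemma char_poly_ublock (R : comNzRingType) m n (A : 'M[R]_m) U (B : 'M[R]_n) :
  char_poly (block_mx A U 0 B) = char_poly A * char_poly B.
Proof.
rewrite /char_poly /char_poly_mx map_block_mx map_mx0 scalar_mx_block.
by rewrite opp_block_mx add_block_mx oppr0 addr0 det_ublock.
Qed.

Lemma castmxB (V : zmodType) m n m' n' (e : (m = m') * (n = n'))
  (A B : 'M[V]_(m, n)) : castmx e (A - B) = castmx e A - castmx e B.
Proof. by apply/matrixP => i j; rewrite !(castmxE, mxE). Qed.

Lemma castmxZ (R : pzRingType) m n m' n' (e : (m = m') * (n = n')) c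
  (A : 'M[R]_(m, n)) : castmx e (c *: A) = c *: castmx e A.
Proof. by apply/matrixP => i j; rewrite !(castmxE, mxE). Qed.

Lemma char_poly_castmx (R : comNzRingType) m n (e : m = n) (A : 'M[R]_m) :
  char_poly (castmx (e, e) A) = char_poly A.
Proof. by case: n / e; rewrite castmx_id. Qed.

(** The two sizes m and n are equal but need not be convertible, so that base
    change also covers reindexing between different block decompositions. *)
Lemma char_poly_conj (R : comNzRingType) m n (g : 'M[R]_(m, n)) h A B :
  g *m h = 1%:M -> h *m g = 1%:M -> B *m h = h *m A ->
  char_poly B = char_poly A.
Proof.
move=> gh hg BhA.
have emn : m = n.
  by apply/eqP; rewrite eqn_leq (mulmx1_min gh) (mulmx1_min hg).
case: n / emn g h gh hg B BhA => g h gh hg B BhA.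
have -> : B = h *m A *m g by rewrite -BhA -mulmxA hg mulmx1.
pose p (M : 'M[R]_m) := map_mx polyC M.
have phg : p h *m p g = 1%:M by rewrite -map_mxM hg map_mx1.
have -> : char_poly (h *m A *m g) = \det (p h *m char_poly_mx A *m p g).
  rewrite /char_poly /char_poly_mx !map_mxM mulmxBr mulmxBl.
  by rewrite scalar_mxC -(mulmxA 'X%:M) phg mulmx1.
by rewrite !det_mulmx mulrAC -det_mulmx phg det1 mul1r.
Qed.

Lemma det_block_scalar (R : comNzRingType) (a b c d : R) :
  \det (block_mx a%:M b%:M c%:M d%:M : 'M_(1 + 1)) = a * d - b * c.
Proof.
rewrite (expand_det_row _ (lshift 1 ord0)) big_split_ord /= !big_ord1.
rewrite block_mxEul block_mxEur /cofactor /= !det_mx11 !mxE.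
rewrite (_ : lift (lshift _ _) _ = rshift 1 ord0); last exact: val_inj.
rewrite (_ : lift (rshift _ _) _ = lshift 1 ord0); last exact: val_inj.
rewrite (unsplitK (inr _)) row_mxEl row_mxEr !mxE eqxx !mulr1n expr0 expr1.
ring.
Qed.

(** * Compositions, last part first *)

Definition weight (mu : seq nat) : nat := (\prod_(i <- mu) (i + 1))%N.
(** Raising the last part of mu by one turns its weight a into 2 a - y, where y
    is this number. *)
Definition coweight (mu : seq nat) : nat :=
  (head 0 mu * weight (behead mu))%N.

Lemma weight_gt0 mu : (0 < weight mu)%N.
Proof. by apply: prodn_gt0 => i; rewrite addn1. Qed.

Lemma weight_cons m mu : weight (m :: mu) = ((m + 1) * weight mu)%N.
Proof. by rewrite /weight big_cons. Qed.

Lemma weight_split mu : weight mu = (coweight mu + weight (behead mu))%N.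
Proof.
case: mu => [|m mu]; first by rewrite /coweight /= mul0n.
by rewrite weight_cons /coweight /= mulnDl mul1n.
Qed.

(** These two values run over the compositions of n + 1, without repetition, as
    mu runs over those of n, provided that n > 0. On the empty sequence they
    coincide, which is why rcomps starts from the composition of 1. *)
Definition extend (mu : seq nat) : seq (seq nat) :=
  [:: (head 0%N mu).+1 :: behead mu; 1%N :: mu].

(** The compositions of n.+1, each written with its last part first. *)
Fixpoint rcomps n : seq (seq nat) :=
  if n is m.+1 then flatten (map extend (rcomps m)) else [:: [:: 1%N]].

Lemma rcomps_extend n : perm_eq (rcomps n.+1)
  ([seq (head 0%N mu).+1 :: behead mu | mu <- rcomps n]
   ++ [seq 1%N :: mu | mu <- rcomps n]).
Proof.
rewrite /=; elim: (rcomps n) => //= mu s IH.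
rewrite perm_cons perm_sym -cat1s perm_catCA /= perm_sym.
by rewrite perm_cons.
Qed.

Lemma mem_rcomps n mu : (mu \in rcomps n) = is_composition n.+1 mu.
Proof.
elim: n mu => [|n IH] mu.
  rewrite /= inE /is_composition; apply/eqP/andP => [-> // | []].
  case: mu => [|[|[|m]] [|[|k] mu]] //=.
rewrite (perm_mem (rcomps_extend n)) mem_cat.
apply/orP/idP => [[/mapP[nu] | /mapP[nu]] | ].
- rewrite IH => /andP[nu_pos /eqP sum_nu] ->; case: nu nu_pos sum_nu => //=.
  move=> k nu /andP[_ nu_pos] sum_nu.
  by rewrite /is_composition /= nu_pos addSn sum_nu eqxx.
- by rewrite IH /is_composition => nuP -> /=.
case: mu => [|[|[|m]] mu] //=.
  by move=> mu_comp; right; apply: map_f; rewrite IH.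
by move=> mu_comp; left; apply/mapP; exists (m.+1 :: mu); rewrite ?IH.
Qed.

Lemma rcomps_uniq n : uniq (rcomps n).
Proof.
elim: n => [//|n IH]; rewrite (perm_uniq (rcomps_extend n)) cat_uniq.
rewrite map_inj_in_uniq ?IH; last first.
  move=> [|k mu] [|l nu] //=; rewrite !mem_rcomps //= => _ _ [-> ->] //.
rewrite map_inj_uniq ?IH; last by move=> mu nu [].
rewrite andbT; apply/hasPn => _ /mapP[mu _ ->]; apply/mapP => -[[|k nu]].
  by rewrite mem_rcomps.
by rewrite mem_rcomps => /andP[/=/andP[k_gt0 _] _] [k0 _]; rewrite -k0 in k_gt0.
Qed.

Lemma perm_compositions n :
  perm_eq (compositions n.+1) [seq rev mu | mu <- rcomps n].
Proof.
apply: uniq_perm; first exact: compositions_uniq.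
  by rewrite (map_inj_uniq (can_inj revK)) rcomps_uniq.
move=> mu; rewrite mem_compositions -[mu in RHS]revK.
rewrite (mem_map (can_inj revK)) mem_rcomps /is_composition sumn_rev.
by rewrite all_rev.
Qed.

Lemma pi_full_rev mu : pi_full (rev mu) = weight mu.
Proof. by rewrite /weight -big_rev (big_nth 0%N) big_mkord. Qed.

Lemma pi_init_rev mu : pi_init (rev mu) = weight (behead mu).
Proof.
case: mu => [|m mu]; first by rewrite /pi_init big_ord0 /weight big_nil.
rewrite /= -pi_full_rev /pi_init rev_cons size_rcons.
by apply: eq_bigr => i _; rewrite nth_rcons ltn_ord.
Qed.

(** * Simultaneous block triangularization *)

Definition block_mxE := (mulmx_block, add_block_mx, opp_block_mx, mul1mx,
  mulmx1, mul0mx, mulmx0, addr0, add0r, subr0, oppr0, mulmxN, mulNmx).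

Section Factors.
Variable F : numFieldType.

(** The passage from (A_n, A_n - B_n) to (A_(n+1), A_(n+1) - B_(n+1)). *)
Definition liftA k (X Y : 'M[F]_k) : 'M_(k + k) := block_mx X X X (Y - X).
Definition liftN k (X : 'M[F]_k) : 'M_(k + k) := block_mx 0 0 X 0.

Definition cellA (a : nat) : 'M[F]_(1 + 1) := block_mx 0 a%:R%:M 1%:M 0.
Definition cellN (y : nat) : 'M[F]_(1 + 1) := block_mx 0 y%:R%:M 0 0.

(** A simultaneous block triangularization of a pair of matrices, with a list of
    compositions naming the diagonal cells. It is generated by block extension
    and base change rather than given by an explicit basis, so that properties
    stable under both are proved by induction. *)
Inductive factors :
    forall k : nat, 'M[F]_k -> 'M[F]_k -> seq (seq nat) -> Prop :=
| factors_cell mu :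
    factors (cellA (weight mu)) (cellN (coweight mu)) [:: mu]
| factors_ext k l (X Y : 'M_k) (X' Y' : 'M_l) U V L L' :
    factors X Y L -> factors X' Y' L' ->
    factors (block_mx X U 0 X') (block_mx Y V 0 Y') (L ++ L')
| factors_conj k l (g : 'M_(k, l)) (h : 'M_(l, k)) X Y X' Y' L :
    g *m h = 1%:M -> h *m g = 1%:M ->
    X' *m h = h *m X -> Y' *m h = h *m Y ->
    factors X Y L -> factors X' Y' L.

Lemma factors_castmx m n (e : m = n) X Y L :
  factors X Y L -> factors (castmx (e, e) X) (castmx (e, e) Y) L.
Proof. by case: n / e; rewrite !castmx_id. Qed.

Lemma scalar_block_1 : 1%:M = block_mx 1%:M 0 0 1%:M :> 'M[F]_(1 + 1).
Proof. exact: scalar_mx_block. Qed.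

(** The heart of the proof: the lift of a cell, of size four, splits into the
    cells of the two extensions of its composition. Inverting the base change
    needs 2 and a = weight mu to be nonzero, as they are in characteristic
    zero. *)
Lemma factors_lift_cell mu :
  factors (liftA (cellA (weight mu)) (cellN (coweight mu)))
    (liftN (cellA (weight mu))) (extend mu).
Proof.
set a := weight mu; set y := coweight mu.
have a_neq0 : a%:R != 0 :> F by rewrite pnatr_eq0 -lt0n weight_gt0.
have ext := factors_ext
  (block_mx y%:R%:M 0 0 0) (block_mx a%:R%:M 0 0 (- a%:R)%:M)
  (factors_cell ((head 0%N mu).+1 :: behead mu)) (factors_cell (1%N :: mu)).
have w1 : weight ((head 0%N mu).+1 :: behead mu) = (a + weight (behead mu))%N.
  rewrite /a (weight_split mu) weight_cons /coweight addn1 !mulSn.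
  by rewrite addnC (addnC (weight _)).
have y1 : coweight ((head 0%N mu).+1 :: behead mu) = a.
  by rewrite /coweight /= mulSn addnC /a (weight_split mu).
have w2 : weight (1%N :: mu) = (a + a)%N by rewrite weight_cons mul2n addnn.
have y2 : coweight (1%N :: mu) = a by rewrite /coweight mul1n.
have ay : a%:R = y%:R + (weight (behead mu))%:R :> F.
  by rewrite -natrD -weight_split.
move: ext; rewrite w1 y1 w2 y2 /=.
(* The columns of h are (0, v), (w, -w), (w, w), (2 a v, 0) in the basis
   (v, 0), (w, 0), (0, v), (0, w); g is its inverse. *)
pose g : 'M[F]_((1 + 1) + (1 + 1)) :=
  block_mx (block_mx 0 0 0 (2^-1)%:M) (block_mx 1%:M 0 0 (- 2^-1)%:M)
           (block_mx 0 (2^-1)%:M (2 * a%:R)^-1%:M 0) (block_mx 0 (2^-1)%:M 0 0).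
pose h : 'M[F]_((1 + 1) + (1 + 1)) :=
  block_mx (block_mx 0 0 0 1%:M) (block_mx 0 (2 * a%:R)%:M 1%:M 0)
           (block_mx 1%:M 0 0 (-1)%:M) (block_mx 0 0 1%:M 0).
apply: (@factors_conj _ _ g h).
- rewrite /g /h !block_mxE -!scalar_mxM.
  rewrite (scalar_mx_block (1 + 1)) !scalar_block_1.
  apply/matrixP => i j; do ![rewrite !mxE; case: (split _) => ?];
    rewrite ?mxE ?ord1 ?eqxx //; field; rewrite ?a_neq0 //.
- rewrite /g /h !block_mxE -!scalar_mxM.
  rewrite (scalar_mx_block (1 + 1)) !scalar_block_1.
  apply/matrixP => i j; do ![rewrite !mxE; case: (split _) => ?];
    rewrite ?mxE ?ord1 ?eqxx //; field; rewrite ?a_neq0 //.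
- rewrite /h /liftA /cellA /cellN !block_mxE -!raddfB -!scalar_mxM.
  apply/matrixP => i j; do ![rewrite !mxE; case: (split _) => ?];
    rewrite ?mxE ?ord1 ?eqxx ?natrD ?ay; ring.
- rewrite /h /liftN /cellA /cellN !block_mxE -!scalar_mxM.
  apply/matrixP => i j; do ![rewrite !mxE; case: (split _) => ?];
    rewrite ?mxE ?ord1 ?eqxx; ring.
Qed.

Lemma factors_lift k (X Y : 'M[F]_k) L :
  factors X Y L -> factors (liftA X Y) (liftN X) (flatten (map extend L)).
Proof.
elim=> {k X Y L} [mu||].
- exact: factors_lift_cell.
- move=> k l X Y X' Y' U V L L' _ IH _ IH'.
  rewrite map_cat flatten_cat.
  (* The base change regroups k + l + k + l as k + k + l + l. *)
  have := factors_ext (block_mx U U U (V - U)) (block_mx 0 0 U 0) IH IH'.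
  apply: (@factors_conj _ _
    (block_mx (block_mx 1%:M 0 0 0) (block_mx 0 0 1%:M 0)
              (block_mx 0 1%:M 0 0) (block_mx 0 0 0 1%:M))
    (block_mx (block_mx 1%:M 0 0 0) (block_mx 0 0 1%:M 0)
              (block_mx 0 1%:M 0 0) (block_mx 0 0 0 1%:M))).
  + by rewrite !block_mxE ?block_mx0 -!scalar_mx_block.
  + by rewrite !block_mxE ?block_mx0 -!scalar_mx_block.
  + by rewrite /liftA !block_mxE.
  + by rewrite /liftN !block_mxE ?block_mx0.
- move=> k l g h X Y X' Y' L gh hg eX eY _.
  apply: (@factors_conj _ _ (block_mx g 0 0 g) (block_mx h 0 0 h)).
  + by rewrite !block_mxE gh -!scalar_mx_block.
  + by rewrite !block_mxE hg -!scalar_mx_block.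
  + by rewrite /liftA !block_mxE mulmxBl mulmxBr eX eY.
  + by rewrite /liftN !block_mxE eX.
Qed.

(** The sign e is there for the sake of - B_n inside B_(n+1), which calls for
    the characteristic polynomials of A_n and - A_n alike. *)
Lemma char_poly_cellA (e : F) a :
  e ^+ 2 = 1 -> char_poly (e *: cellA a) = 'X^2 - a%:R%:P.
Proof.
move=> e2; rewrite /cellA scale_block_mx !scaler0.
rewrite /char_poly /char_poly_mx map_block_mx !scale_scalar_mx !map_scalar_mx.
rewrite map_mx0 scalar_mx_block !block_mxE -!raddfN /= det_block_scalar.
by rewrite -rmorphM mulr1 mulrNN mulrAC -!expr2 e2 mul1r polyCN.
Qed.

Lemma char_poly_factors (e : F) k (X Y : 'M[F]_k) L :
  e ^+ 2 = 1 -> factors X Y L ->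
  char_poly (e *: X) = \prod_(mu <- L) ('X^2 - (weight mu)%:R%:P).
Proof.
move=> e2; elim=> {k X Y L}.
- by move=> mu; rewrite big_seq1 char_poly_cellA.
- move=> k l X Y X' Y' U V L L' _ IH _ IH'.
  by rewrite scale_block_mx scaler0 char_poly_ublock IH IH' big_cat.
- move=> k l g h X Y X' Y' L gh hg eX _ _ <-.
  by apply: (char_poly_conj gh hg); rewrite -scalemxAl -scalemxAr eX.
Qed.

(** * The matrices A and B *)

Lemma liftA_mxA n :
  mxA F n.+1 = castmx (addn_exp2 n, addn_exp2 n)
    (liftA (mxA F n) (mxA F n - mxB F n)).
Proof. by rewrite /liftA addrAC subrr add0r. Qed.

Lemma liftN_mxA n :
  mxA F n.+1 - mxB F n.+1
  = castmx (addn_exp2 n, addn_exp2 n) (liftN (mxA F n)).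
Proof.
rewrite /= -castmxB /liftN; congr castmx.
by rewrite opp_block_mx add_block_mx !subrr subr0.
Qed.

Lemma factors_mxA n : factors (mxA F n.+1) (mxA F n.+1 - mxB F n.+1) (rcomps n).
Proof.
elim: n => [|n IH]; rewrite liftN_mxA liftA_mxA; apply: factors_castmx.
  rewrite /= subrr.
  have -> : const_mx 1 = 1%:M :> 'M[F]_(2 ^ 0).
    by apply/matrixP => i j; rewrite !mxE !ord1 eqxx.
  have := factors_cell [:: 1%N].
  rewrite /coweight weight_cons /weight !big_nil /=.
  (* v = (0, 1) and w = A_1 v = (1, -1). *)
  pose h : 'M[F]_(2 ^ 0 + 2 ^ 0, 1 + 1) := block_mx 0 1%:M 1%:M (- 1%:M).
  pose g : 'M[F]_(1 + 1, 2 ^ 0 + 2 ^ 0) := block_mx 1%:M 1%:M 1%:M 0.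
  apply: (@factors_conj _ _ g h).
  - by rewrite /g /h !block_mxE subrr -!scalar_mx_block.
  - by rewrite /g /h !block_mxE subrr -!scalar_mx_block.
  - by rewrite /h /liftA /cellA !block_mxE subrr opprK -raddfD.
  - by rewrite /h /liftN /cellN !block_mxE.
exact: factors_lift.
Qed.

Lemma char_poly_mxA (e : F) n : e ^+ 2 = 1 ->
  char_poly (e *: mxA F n.+1)
  = \prod_(mu <- rcomps n) ('X^2 - (weight mu)%:R%:P).
Proof. by move=> e2; apply: char_poly_factors e2 (factors_mxA n). Qed.

Lemma char_poly_mxB0 (c : F) : char_poly (c *: mxB F 0) = 'X - c%:P.
Proof.
rewrite /char_poly (det_mx11 (char_poly_mx _)) !mxE eqxx mulr1.
by rewrite mulr1n.
Qed.

(** In the induction step the factors of the block A are those of the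
    compositions 1 :: mu, as mu is what remains without the last part; those of
    the block - B belong to the compositions whose last part was raised, which
    does not affect the remaining parts. *)
Lemma char_poly_mxB (e : F) n : e ^+ 2 = 1 ->
  char_poly (e *: mxB F n.+1)
  = \prod_(mu <- rcomps n) ('X^2 - (weight (behead mu))%:R%:P).
Proof.
have split_mxB m (c : F) : char_poly (c *: mxB F m.+1)
    = char_poly (c *: mxA F m) * char_poly (- c *: mxB F m).
  rewrite /= -castmxZ char_poly_castmx scale_block_mx scaler0.
  by rewrite char_poly_ublock scalerN scaleNr.
elim: n e => [|n IH] e e2; rewrite split_mxB.
  rewrite !char_poly_mxB0 big_seq1 /weight big_nil polyCN opprK -subr_sqr.
  by rewrite -rmorphXn /= e2.
rewrite char_poly_mxA // IH ?sqrrN // (perm_big _ (rcomps_extend n)) big_cat.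
rewrite !big_map mulrC; congr (_ * _).
Qed.

End Factors.

(** * Roots *)

Lemma prod_sqrt_pairs (C : numClosedFieldType) (s : seq nat) :
  \prod_(z <- sqrt_pairs C s) ('X - z%:P) = \prod_(a <- s) ('X^2 - a%:R%:P).
Proof.
rewrite big_flatten big_map; apply: eq_bigr => a _.
rewrite big_cons big_seq1 polyCN opprK /= -subr_sqr -rmorphXn.
by rewrite /= sqrtCK.
Qed.

Lemma perm_poly_roots (C : closedFieldType) (p : {poly C}) s :
  p = \prod_(z <- s) ('X - z%:P) -> perm_eq (poly_roots p) s.
Proof.
move=> pE; apply: prod_XsubC_eq; rewrite -pE /poly_roots.
have p1 : lead_coef p = 1 by apply/monicP; rewrite pE monic_prod_XsubC.
by case: closed_field_poly_normal => r /=; rewrite p1 scale1r => <-.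
Qed.

Theorem theorem1 (C : numClosedFieldType) (n : nat) (n_ge1 : (1 <= n)%N) :
  perm_eq (poly_roots (char_poly (mxA C n)))
          (sqrt_pairs C [seq pi_full mu | mu <- compositions n]) /\
  perm_eq (poly_roots (char_poly (mxB C n)))
          (sqrt_pairs C [seq pi_init mu | mu <- compositions n]).
Proof.
case: n n_ge1 => // n _.
split; apply: perm_poly_roots; rewrite prod_sqrt_pairs big_map.
  rewrite -[mxA C n.+1]scale1r char_poly_mxA ?expr1n //.
  rewrite (perm_big _ (perm_compositions n)) big_map /=.
  by apply: eq_bigr => mu _; rewrite pi_full_rev.
rewrite -[mxB C n.+1]scale1r char_poly_mxB ?expr1n //.
rewrite (perm_big _ (perm_compositions n)) big_map /=.
by apply: eq_bigr => mu _; rewrite pi_init_rev.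
Qed.
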